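(* Let $r>1$ be a natural number. If $A$ is a bounded $r$-regular subset of $[0,1]^d$ and there is some $i\in\{1,\dots,d\}$ such that $0<d_H(\overline{\pi_i(A)})<1$, then there exists a unary Cantor set $X$ (that is, a Cantor set $X\subseteq\mathbb{R}$) definable in $\mathcal{R}_A=(\mathbb{R},<,+,0,1,A)$.
   Context: Write $[r]=\{0,\dots,r-1\}$. A Büchi automaton over a finite alphabet $\Sigma$ is a finite automaton (finite set of states, initial state, transitions, set of accept states) reading infinite words in $\Sigma^\omega$; it accepts a word $w$ if some run on $w$ visits accept states infinitely often. A language $L\subseteq\Sigma^\omega$ is regular if it is the set of words accepted by some Büchi automaton. For $w=w_0w_1\cdots\in[r]^\omega$ put $\nu_r(w)=\sum_{i\ge0} w_i r^{-(i+1)}\in[0,1]$; extend $\nu_r$ coordinatewise to $\nu_r:([r]^d)^\omega\to[0,1]^d$. A set $A\subseteq[0,1]^d$ is $r$-regular if $A=\nu_r(L)$ for some regular $L\subseteq([r]^d)^\omega$. The map $\pi_i:\mathbb{R}^d\to\mathbb{R}$ is projection onto the $i$-th coordinate, $\overline{\,\cdot\,}$ is topological closure, and $d_H$ is Hausdorff dimension. A Cantor set is a nonempty subset of Euclidean space that is compact, has no isolated points and has empty interior. In $\mathcal{R}_A$ the set $A$ is named by a $d$-ary predicate; definable means first-order definable. *)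

(* Defs.v *)
From HB Require Import structures.
From mathcomp Require Import all_boot all_order all_algebra.
From mathcomp Require Import all_classical all_reals all_analysis.
Import numFieldNormedType.Exports.

Set Implicit Arguments.
Unset Strict Implicit.
Unset Printing Implicit Defensive.

Import Order.TTheory GRing.Theory Num.Theory.

Local Open Scope classical_set_scope.
Local Open Scope ring_scope.

Definition word (S : Type) := nat -> S.

Record buchi (S : finType) := Buchi {
  state : finType;
  init : state;
  trans : state -> S -> state -> bool;
  final : {set state} }.

Definition is_run (S : finType) (M : buchi S) (w : word S)
    (rho : nat -> state M) : Prop :=
  rho 0%N = init M /\ forall n, trans (rho n) (w n) (rho n.+1).

Definition accepts (S : finType) (M : buchi S) (w : word S) : Prop :=
  exists rho : nat -> state M, is_run w rho /\
    forall N, exists n, (N <= n)%N /\ rho n \in final M.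

Definition omega_regular (S : finType) (L : set (word S)) : Prop :=
  exists M : buchi S, L = [set w | accepts M w].

Definition nu (R : realType) (r : nat) (w : word 'I_r) : R :=
  limn (series (fun i => (w i)%:R / r%:R ^+ i.+1 : R)).

(* A letter of the alphabet [r]^d is a d-tuple of digits. *)
Definition nu_vec (R : realType) (r d : nat)
    (w : word {ffun 'I_d -> 'I_r}) : 'rV[R]_d :=
  \row_j nu R (fun i => w i j).

Definition r_regular (R : realType) (r d : nat) (A : set 'rV[R]_d) : Prop :=
  exists L : set (word {ffun 'I_d -> 'I_r}),
    omega_regular L /\ A = @nu_vec R r d @` L.

Definition unit_cube (R : realType) (d : nat) : set 'rV[R]_d :=
  [set x | forall j, 0 <= x 0 j <= 1].
Arguments unit_cube : clear implicits.

Definition coord_proj (R : realType) (d : nat) (i : 'I_d) (x : 'rV[R]_d) : R := x 0 i.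

Section Hausdorff.
Context {R : realType} {T : normedModType R}.
Local Open Scope ereal_scope.

Definition diam (U : set T) : \bar R :=
  ereal_sup [set (`|p.1 - p.2|)%:E | p in U `*` U].

(* The empty set has weight 0 even for s = 0, so that the 0-dimensional
   measure is the counting measure; poweR alone would give it weight 1.
   For s = 0 a singleton has weight 0 `^ 0 = 1. *)
Definition diam_pow (s : R) (U : set T) : \bar R :=
  if U == set0 then 0 else poweR (diam U) s.

Definition hausdorff_premeasure (s delta : R) (E : set T) : \bar R :=
  ereal_inf [set \sum_(n <oo) diam_pow s (U n) | U in
    [set U : nat -> set T | E `<=` \bigcup_n U n /\
                            forall n, diam (U n) <= delta%:E]].

(* The premeasure increases as delta decreases, so the limit at 0 is a sup. *)
Definition hausdorff_measure (s : R) (E : set T) : \bar R :=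
  ereal_sup [set hausdorff_premeasure s delta E
            | delta in [set delta : R | (0 < delta)%R]].

Definition hausdorff_dim (E : set T) : \bar R :=
  ereal_inf [set s%:E | s in
    [set s : R | (0 <= s)%R /\ hausdorff_measure s E = 0]].

End Hausdorff.

Definition cantor_set (T : topologicalType) (X : set T) : Prop :=
  [/\ X !=set0, compact X, isolated X = set0 & interior X = set0].

(* Terms and formulas over n free variables; A is a d-ary predicate symbol.
   Under a quantifier, variable 0 is the bound one. *)
Inductive term (n : nat) : Type :=
| TVar of 'I_n
| TZero
| TOne
| TAdd of term n & term n.

Inductive formula (d : nat) : nat -> Type :=
| FEq n of term n & term n : formula d n
| FLt n of term n & term n : formula d n
| FPred n of ('I_d -> term n) : formula d n
| FNot n of formula d n : formula d n
| FAnd n of formula d n & formula d n : formula d n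
| FExists n of formula d n.+1 : formula d n.

Section Semantics.
Context {R : realType} {d : nat}.
Variable A : set 'rV[R]_d.

Fixpoint eval n (e : 'I_n -> R) (t : term n) : R :=
  match t with
  | TVar i => e i
  | TZero => 0
  | TOne => 1
  | TAdd t1 t2 => eval e t1 + eval e t2
  end.

Definition extend n (x : R) (e : 'I_n -> R) (i : 'I_n.+1) : R :=
  oapp e x (unlift ord0 i).

Fixpoint holds n (f : formula d n) : ('I_n -> R) -> Prop :=
  match f with
  | FEq _ t1 t2 => fun e => eval e t1 = eval e t2
  | FLt _ t1 t2 => fun e => eval e t1 < eval e t2
  | FPred _ t => fun e => A (\row_j eval e (t j))
  | FNot _ g => fun e => ~ holds g e
  | FAnd _ g h => fun e => holds g e /\ holds h e
  | FExists _ g => fun e => exists x : R, holds g (extend x e)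
  end.

(* Definability is without parameters; 0 and 1 are in the language. *)
Definition definable n (X : set 'rV[R]_n) : Prop :=
  exists f : formula d n, X = [set v | holds f (fun i => v 0 i)].

Definition definable1 (X : set R) : Prop :=
  definable [set v : 'rV[R]_1 | X (v 0 0)].

End Semantics.

(* Main.v *)
(* For a state q of the automaton let C q be the closure of the set of i-th
   coordinates of the points read from q, so that C init is the closure of the
   projection. The C q satisfy C q = \bigcup_(q -a-> q') (a_i + C q') / r. Passing
   to limit points commutes with finite unions and affine maps, so every
   Cantor-Bendixson derivative of (C q)_q solves the same system; as the maps
   contract, a closed solution is determined by the set of q where it is
   nonempty. These finite sets decrease, so the derivatives become stationary
   after finitely many, hence definable, steps. The stationary set X at init is
   perfect. It is nonempty, since otherwise C init would be countable and of
   dimension 0, and it has empty interior, since C init has dimension < 1. *)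
Require Import Defs.
From mathcomp Require Import all_boot all_order all_algebra.
From mathcomp Require Import all_classical all_reals all_analysis.
From mathcomp Require Import lra.
Import numFieldNormedType.Exports.
Import Order.TTheory GRing.Theory Num.Theory.

Set Implicit Arguments.
Unset Strict Implicit.
Unset Printing Implicit Defensive.

Local Open Scope classical_set_scope.
Local Open Scope ring_scope.

(** * First-order definability *)

Lemma extend0 (R : realType) n (x : R) (e : 'I_n -> R) : extend x e ord0 = x.
Proof. by rewrite /extend unlift_none. Qed.

Lemma extend_lift (R : realType) n (x : R) (e : 'I_n -> R) i :
  extend x e (lift ord0 i) = e i.
Proof. by rewrite /extend liftK. Qed.

(** The context is written [m + n] because [m.+1 + n] reduces to [(m + n).+1], so each [FExists]
    types without a cast. The [lshift] variables get bound, the [rshift] variables stay free. *)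
Fixpoint exists_block (d n m : nat) : formula d (m + n) -> formula d n :=
  match m return formula d (m + n) -> formula d n with
  | 0 => id
  | m.+1 => fun f => @exists_block d n m (FExists f)
  end.

Lemma holds_exists_block (R : realType) (d : nat) (A : set 'rV[R]_d) n m
    (f : formula d (m + n)) (e : 'I_n -> R) :
  holds A (@exists_block d n m f) e <->
  exists g : 'I_(m + n) -> R, g \o @rshift m n = e /\ holds A f g.
Proof.
elim: m f => [|m IH] f.
  split=> [hf|[g [<- hf]]].
    exists e; split => //; apply/funext => i /=; congr (e _); exact: val_inj.
  suff -> : g \o @rshift 0 n = g by [].
  by apply/funext => i /=; congr (g _); exact: val_inj.
split=> /=.
  move=> H; have [g [<- [x hf]]] := proj1 (IH (@FExists d (m + n) f)) H.
  exists (extend x g); split => //.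
  apply/funext => i /=; rewrite -[RHS](extend_lift x).
  by congr (extend _ _ _); exact: val_inj.
move=> [g [ge hf]]; apply/(IH (@FExists d (m + n) f)).
exists (g \o lift ord0); split.
  by rewrite -ge; apply/funext => i /=; congr (g _); exact: val_inj.
exists (g ord0) => /=; suff -> : extend (g ord0) (g \o lift ord0) = g by [].
by apply/funext => i; rewrite /extend; case: unliftP => [j|] ->.
Qed.

(* Quantifying over all contexts and all variables makes the class of these
   sets closed under first-order constructions without any substitution. *)
Definition expressible (R : realType) (d : nat) (A : set 'rV[R]_d)
    (X : set R) : Prop :=
  forall n (i : 'I_n), exists f : formula d n,
    forall e, holds A f e <-> X (e i).

Lemma expressible_definable1 (R : realType) (d : nat) (A : set 'rV[R]_d)
    (X : set R) : expressible A X -> definable1 A X.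
Proof.
move=> /(_ 1%N ord0)[f fX]; exists f.
by apply/seteqP; split=> v /=; rewrite fX.
Qed.

Lemma expressible_coord_proj (R : realType) (d : nat) (A : set 'rV[R]_d)
    (i : 'I_d) : expressible A (coord_proj i @` A).
Proof.
move=> n k.
exists (@exists_block d n d
  (FAnd (FPred (fun j => TVar (lshift n j)))
        (FEq _ (TVar (lshift n i)) (TVar (rshift d k))))) => e.
rewrite holds_exists_block; split=> [[g [<- [Ag gi]]]|[v Av vk]].
  by exists (\row_j g (lshift n j)) => //; rewrite /coord_proj mxE; exact: gi.
(* The witness assigns the coordinates of [v] to the [d] bound variables and keeps [e] on the
   others. *)
exists (fun j : 'I_(d + n) =>
  match fintype.split j with inl a => v 0 a | inr b => e b end).
split; first by apply/funext => j /=; rewrite (unsplitK (inr j)).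
split; last by rewrite /= (unsplitK (inl i)) (unsplitK (inr k)) -vk.
rewrite /= [X in A X](_ : _ = v) //.
by apply/rowP => j; rewrite mxE (unsplitK (inl j)).
Qed.

Definition FImply d n (f g : formula d n) := FNot (FAnd f (FNot g)).
Definition FForall d n (f : formula d n.+1) := FNot (FExists (FNot f)).

Lemma holds_FImply (R : realType) (d : nat) (A : set 'rV[R]_d) n
    (f g : formula d n) e :
  holds A (FImply f g) e <-> (holds A f e -> holds A g e).
Proof. by rewrite /=; split=> [/not_andP[//|/contrapT]|fg [/fg]]. Qed.

Lemma holds_FForall (R : realType) (d : nat) (A : set 'rV[R]_d) n
    (f : formula d n.+1) e :
  holds A (FForall f) e <-> forall x, holds A f (extend x e).
Proof.
by split=> [nf x|nf [x /(_ (nf x))//]]; apply: contrapT => nh; apply: nf; exists x.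
Qed.

(** A formula can quantify over the two endpoints of an interval, but not over neighbourhoods. *)
Lemma nbhs_itvP (R : realType) (x : R) (U : set R) :
  nbhs x U <-> exists a b, a < x < b /\ forall y, a < y < b -> U y.
Proof.
split=> [/nbhs_ballP[e /= e0 eU]|[a [b [/andP[ax xb] U_ab]]]].
  exists (x - e), (x + e); split; first by rewrite ltrBlDr !ltrDl e0.
  by move=> y xy; apply: eU; rewrite /ball /= distrC ltr_distl.
by apply: filterS (near_in_itvoo _); [exact: U_ab | rewrite in_itv /= ax].
Qed.

Lemma expressible_limit_point (R : realType) (d : nat) (A : set 'rV[R]_d)
    (X : set R) : expressible A X -> expressible A (limit_point X).
Proof.
move=> expX n i.
(* Under the three quantifiers (all [a], all [b], some [y]), the innermost [y] is variable 0, [b] is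
   1, [a] is 2, and the free variable [x] is shifted by three. The formula says that whenever a < x
   < b, some y in X other than x lies between a and b. *)
pose a : 'I_n.+3 := lift ord0 (lift ord0 ord0).
pose b : 'I_n.+3 := lift ord0 ord0.
pose x : 'I_n.+3 := lift ord0 (lift ord0 (lift ord0 i)).
have [f fX] := expX n.+3 ord0.
pose lt2 m (u v w : 'I_m) : formula d m :=
  FAnd (FLt _ (TVar u) (TVar v)) (FLt _ (TVar v) (TVar w)).
exists (FForall (FForall (FImply
  (lt2 _ (lift ord0 ord0) (lift ord0 (lift ord0 i)) ord0)
  (FExists (FAnd (lt2 _ a ord0 b)
                 (FAnd (FNot (FEq _ (TVar ord0) (TVar x))) f)))))) => e.
rewrite holds_FForall; split=> [H U /nbhs_itvP[u [v [/andP[ux xv] U_uv]]]|H u].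
  have {H} /holds_FForall /(_ v) /holds_FImply := H u.
  rewrite /= /a /b /x !(extend0, extend_lift) => /(_ (conj ux xv))[y].
  rewrite !(extend0, extend_lift) fX extend0 => -[[uy yv] [/eqP yx Xy]].
  by exists y; split=> //; apply: U_uv; rewrite uy.
apply/holds_FForall => v; apply/holds_FImply.
rewrite /= /a /b /x !(extend0, extend_lift) => -[ux xv].
have [|y [yx Xy /andP[uy yv]]] := H [set y | u < y < v].
  by apply/nbhs_itvP; exists u, v; rewrite ux xv.
exists y; rewrite !(extend0, extend_lift) fX extend0.
by do !split=> //; exact/eqP.
Qed.

Lemma expressible_setU (R : realType) (d : nat) (A : set 'rV[R]_d)
    (X Y : set R) :
  expressible A X -> expressible A Y -> expressible A (X `|` Y).
Proof.
move=> eX eY n i; have [f fX] := eX n i; have [g gY] := eY n i.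
exists (FNot (FAnd (FNot f) (FNot g))) => e /=; rewrite fX gY.
split=> [/not_andP[/contrapT|/contrapT]|]; [by left|by right|].
by move=> [Xe|Ye] [].
Qed.

(** * Hausdorff dimension of subsets of the line *)

Section HausdorffDim.
Local Open Scope ereal_scope.

Lemma diam_pow_ge0 (R : realType) (s : R) (U : set R) : 0 <= diam_pow s U.
Proof. by rewrite /diam_pow; case: ifP => // _; exact: poweR_ge0. Qed.

Lemma diam_ge (R : realType) (U : set R) x y :
  U x -> U y -> (`|x - y|)%:E <= diam U.
Proof. by move=> Ux Uy; apply: ereal_sup_ubound; exists (x, y). Qed.

Lemma hausdorff_premeasure_ge0 (R : realType) (s delta : R) (E : set R) :
  0 <= hausdorff_premeasure s delta E.
Proof.
apply/ereal_infP => _ [U _ <-]; apply: nneseries_ge0 => n _ _.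
exact: diam_pow_ge0.
Qed.

Lemma diam_subset1 (R : realType) (x : R) (U : set R) :
  U `<=` [set x] -> diam U <= 0.
Proof.
move=> Ux; apply/ereal_supP => _ [[a b] [/= /Ux -> /Ux ->] <-].
by rewrite subrr normr0.
Qed.

Lemma countable_hausdorff_measure (R : realType) (s : R) (E : set R) :
  (0 < s)%R -> countable E -> hausdorff_measure s E = 0.
Proof.
move=> s0 /countable_injP[f f_inj].
(* The fibres of the injection have at most one point, so they cover [E] by sets of weight 0: empty
   ones by convention, singletons because s > 0. *)
pose U n : set R := [set x | E x /\ f x = n].
have U1 n : exists x, U n `<=` [set x].
  have [[x [Ex fx]]|nU] := pselect (exists x, U n x).
    by exists x => y [Ey fy]; apply: f_inj; rewrite ?inE // fx.
  by exists 0%R => y Uy; case: nU; exists y.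
have Upow n : diam_pow s (U n) = 0.
  rewrite /diam_pow; case: ifPn => [//|/set0P[x Ux]].
  have [y /diam_subset1 d0] := U1 n.
  suff -> : diam (U n) = 0 by rewrite poweR0r // gt_eqF.
  apply/eqP; rewrite eq_le d0 /=.
  by apply: le_trans (diam_ge Ux Ux); rewrite lee_fin.
have pre0 delta : (0 < delta)%R -> hausdorff_premeasure s delta E = 0.
  move=> delta0; apply/eqP; rewrite eq_le hausdorff_premeasure_ge0 andbT.
  apply: ge_ereal_inf; exists 0 => //; exists U; last by apply: eseries0.
  split=> [x Ex|n]; first by exists (f x).
  by have [y /diam_subset1/le_trans] := U1 n; apply; rewrite lee_fin ltW.
apply/eqP; rewrite eq_le; apply/andP; split.
  by apply/ereal_supP => _ [delta /= delta0 <-]; rewrite pre0.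
by apply: le_ereal_sup_tmp; exists 0 => //; exists 1%R => //=; rewrite pre0.
Qed.

Lemma countable_hausdorff_dim (R : realType) (E : set R) :
  countable E -> hausdorff_dim E <= 0.
Proof.
move=> cE; apply/lee_addgt0Pr => e e0; rewrite add0e.
apply: ge_ereal_inf; exists e%:E => //; exists e => //.
by split; [exact: ltW|exact: countable_hausdorff_measure].
Qed.

Lemma diam_pow_ge (R : realType) (s : R) (U : set R) :
  (s < 1)%R -> U !=set0 -> diam U <= 1 -> diam U <= diam_pow s U.
Proof.
move=> s1 U0; rewrite /diam_pow ifF; last by apply/negbTE/set0P.
have : 0 <= diam U.
  by have [x Ux] := U0; apply: le_trans (diam_ge Ux Ux); rewrite lee_fin.
case: (diam U) => // t; rewrite !lee_fin => t0 t1.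
have [->|t_neq0] := eqVneq t 0%R.
  exact: powR_ge0.
by apply: ger1_powR; rewrite ?(ltW s1) // t1 andbT lt_neqAle eq_sym t_neq0.
Qed.

(** The interval from infimum to supremum works. It lets a possibly nonmeasurable covering set be
    replaced by one whose Lebesgue measure is at most the diameter. *)
Lemma diam_itv_cover (R : realType) (U : set R) :
  U !=set0 -> diam U <= 1 ->
  exists a b : R, U `<=` `[a, b] /\ (b - a)%:E <= diam U.
Proof.
move=> [x Ux] dU.
have bd y : U y -> (`|x - y| <= 1)%R.
  by move=> Uy; rewrite -lee_fin; apply: le_trans dU; exact: diam_ge.
have ubU : has_ubound U.
  by exists (x + 1)%R => y /bd; rewrite distrC ler_distl => /andP[].
have lbU : has_lbound U.
  by exists (x - 1)%R => y /bd; rewrite distrC ler_distl => /andP[].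
exists (inf U), (sup U); split.
  by move=> y Uy /=; rewrite in_itv /= ge_inf // ub_le_sup.
have d0 : 0 <= diam U by apply: le_trans (diam_ge Ux Ux); rewrite lee_fin.
case: (diam U) dU d0 (@diam_ge R U) => // t _ _ tU; rewrite lee_fin lerBlDr.
apply: ge_sup; first by exists x.
move=> y Uy; rewrite -lerBlDl; apply: lb_le_inf; first by exists x.
move=> z Uz; rewrite lerBlDl -lerBlDr.
by have := tU _ _ Uy Uz; rewrite lee_fin; apply: le_trans; exact: ler_norm.
Qed.

(** For sets of diameter at most 1 and s < 1, the diameter is at most its s-th power. A cover with
    small s-weight therefore has small total length and cannot cover an interval. *)
Lemma hausdorff_dim_lt1_interior (R : realType) (E : set R) :
  hausdorff_dim E < 1 -> interior E = set0.
Proof.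
move=> /ereal_inf_lt[_ [s [s0 Es] <-]]; rewrite lte_fin => s1.
apply/seteqP; split=> // x /nbhs_ballP[e /= e0 eE].
(* The value e / 2 is the length of an interval starting at [x] and contained in the ball; delta = 1
   provides the bound on diameters. *)
have : hausdorff_premeasure s 1 E < (e / 2)%:E.
  apply: le_lt_trans (_ : 0 < (e / 2)%:E); last by rewrite lte_fin divr_gt0.
  by rewrite -Es; apply: ereal_sup_ubound; exists 1%R => //=.
move=> /ereal_inf_lt[_ [U [EU dU] <-]]; apply/negP; rewrite -leNgt.
have /choice[V UV] : forall n, exists Vn : set R,
    [/\ U n `<=` Vn, measurable Vn & lebesgue_measure Vn <= diam_pow s (U n)].
  move=> n.
  have [U0|/set0P Un0] := eqVneq (U n) set0.
    by exists set0; rewrite measure0 U0; split=> //; exact: diam_pow_ge0.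
  have [a [b [Uab ab]]] := diam_itv_cover Un0 (dU n).
  exists `[a, b]%classic; split=> //.
  apply: le_trans (diam_pow_ge s1 Un0 (dU n)).
  rewrite lebesgue_measure_itv /=; case: ifP => // _.
  by have [z Uz] := Un0; apply: le_trans (diam_ge Uz Uz); rewrite lee_fin.
have eV : `[x, (x + e / 2)%R]%classic `<=` \bigcup_n V n.
  move=> y /=; rewrite in_itv /= => /andP[xy ye].
  have /EU[n _ Uny] : E y.
    apply: eE; rewrite /ball /= distrC ltr_distl; apply/andP; split.
      by rewrite ltrBlDr (le_lt_trans xy) // ltrDl.
    by rewrite (le_lt_trans ye) // ltrD2l ltr_pdivrMr // ltr_pMr // ltr1n.
  by exists n => //; have [UVn _ _] := UV n; exact: UVn.
have : lebesgue_measure (`[x, (x + e / 2)%R]%classic : set R)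
    <= \sum_(n <oo) lebesgue_measure (V n).
  by apply: measure_sigma_subadditive => // n; have [] := UV n.
rewrite lebesgue_measure_itv /= lte_fin ltrDl divr_gt0 //.
rewrite -EFinB addrAC subrr add0r => /le_trans; apply.
by apply: lee_nneseries => n _ //; have [] := UV n.
Qed.
End HausdorffDim.

(** * Values of base r expansions *)

Lemma nu_series_le1 (R : realType) (r : nat) (w : word 'I_r) n :
  series (fun i => (w i)%:R / r%:R ^+ i.+1 : R) n <= 1 - r%:R ^- n.
Proof.
have r0 : (0 < r)%N by apply: leq_ltn_trans (ltn_ord (w 0%N)).
(* The induction needs the term r^-n: one more digit adds at most (r - 1) / r^(n+1) = r^-n -
   r^-(n+1). *)
elim: n => [|n IH]; first by rewrite /series /= big_geq // expr0 invr1 subrr.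
rewrite seriesSr; apply: le_trans (lerD IH (lexx _)) _.
have rn0 : (0 : R) < r%:R ^+ n.+1 by rewrite exprn_gt0 // ltr0n.
rewrite -addrA lerD2l addrC -lerBrDr opprK lter_pdivrMr // mulrDl mulNr.
rewrite mulVf ?gt_eqF // exprS mulrCA mulVf ?mulr1; last first.
  by rewrite gt_eqF // exprn_gt0 // ltr0n.
by rewrite addrC lerBrDr natr1 ler_nat.
Qed.

Lemma nu_series_nd (R : realType) (r : nat) (w : word 'I_r) :
  nondecreasing_seq (series (fun i => (w i)%:R / r%:R ^+ i.+1 : R)).
Proof.
by apply/nondecreasing_seqP => n; rewrite seriesSr lerDl divr_ge0 // exprn_ge0.
Qed.

Lemma is_cvg_nu_series (R : realType) (r : nat) (w : word 'I_r) :
  cvgn (series (fun i => (w i)%:R / r%:R ^+ i.+1 : R)).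
Proof.
apply: nondecreasing_is_cvgn; first exact: nu_series_nd.
exists 1 => _ [n _ <-]; apply: le_trans (nu_series_le1 _ _ _) _.
by rewrite gerBl invr_ge0 exprn_ge0.
Qed.

Lemma nu_itv (R : realType) (r : nat) (w : word 'I_r) : 0 <= nu R w <= 1.
Proof.
apply/andP; split.
  apply: limr_ge; first exact: is_cvg_nu_series.
  by apply: nearW => n; apply: sumr_ge0 => i _; rewrite divr_ge0 // exprn_ge0.
apply: limr_le; first exact: is_cvg_nu_series.
apply: nearW => n; apply: le_trans (nu_series_le1 _ _ _) _.
by rewrite gerBl invr_ge0 exprn_ge0.
Qed.

Lemma nu_shift (R : realType) (r : nat) (w : word 'I_r) :
  nu R w = ((w 0%N)%:R + nu R (fun n => w n.+1)) / r%:R.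
Proof.
apply/cvg_lim => //; rewrite -cvg_shiftS.
pose u := series (fun i => (w i.+1)%:R / r%:R ^+ i.+1 : R).
rewrite (_ : [sequence _]_n = (fun n => ((w 0%N)%:R + u n) / r%:R)); last first.
  apply/funext => n /=; rewrite /series /= /u /series /= big_nat_recl //=.
  rewrite mulrDl expr1 mulr_suml; congr (_ + _); apply: eq_bigr => i _.
  by rewrite (exprSr _ i.+1) invfM mulrA.
apply: cvgMl; apply: cvgD; first exact: cvg_cst.
exact: is_cvg_nu_series.
Qed.

(** * Derived sets and graph-directed systems *)

Lemma closure_setU_limit_point (T : topologicalType) (E : set T) :
  closure E = E `|` limit_point E.
Proof.
apply/seteqP; split=> [|x [|]].
- by rewrite closure_isolated_limit_point => x [/isolatedS|]; [left|right].
- exact: subset_closure.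
- exact: subset_limit_point.
Qed.

Section GraphDirected.
Variables (R : realType) (Q S : finType) (r : nat).
Variables (trans : Q -> S -> Q -> bool) (dig : S -> nat).
Hypothesis r_gt1 : (1 < r)%N.

Let f (a : S) (x : R) : R := ((dig a)%:R + x) / r%:R.

(** The self-similarity equations of a graph-directed iterated function system. A pair [p] is the
    letter and the target state of an edge leaving [q]. *)
Definition graph_directed (X : Q -> set R) : Prop :=
  forall q, X q = [set x | exists p : S * Q, trans q p.1 p.2 /\ (f p.1 @` X p.2) x].

Let r0 : (r%:R : R) != 0. Proof. by rewrite pnatr_eq0; case: (r) r_gt1. Qed.

Let fB a x y : f a x - f a y = (x - y) / r%:R.
Proof. by rewrite /f -mulrBl opprD addrACA subrr add0r. Qed.

Let f_inj a : injective (f a).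
Proof. by move=> x y /(divIf r0)/addrI. Qed.

Let f_cont a : continuous (f a).
Proof.
move=> x; apply: cvgMl; apply: cvgD; [exact: cvg_cst|exact: cvg_id].
Qed.

Let g (a : S) (y : R) : R := y * r%:R - (dig a)%:R.

Let fK a : cancel (f a) (g a).
Proof. by move=> x; rewrite /f /g divfK // addrAC subrr add0r. Qed.

Let gK a : cancel (g a) (f a).
Proof. by move=> x; rewrite /f /g addrC subrK mulfK. Qed.

Let g_cont a : continuous (g a).
Proof.
move=> x; apply: cvgB; [apply: cvgMl; exact: cvg_id|exact: cvg_cst].
Qed.

Let limit_point_f a (X : set R) x :
  limit_point X x -> limit_point (f a @` X) (f a x).
Proof.
move=> Xx U /(@f_cont a x) /Xx[y [yx Xy Uy]].
by exists (f a y); split; [rewrite (inj_eq (@f_inj a))|exists y|].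
Qed.

Lemma graph_directed_limit_point (X : Q -> set R) :
  graph_directed X -> graph_directed (limit_point \o X).
Proof.
move=> XE q; apply/seteqP; split=> [x|_ [[a q'] /= [qq' [y Xy <-]]]]; last first.
  move=> U /(@limit_point_f a _ _ Xy)[z [zy Xz Uz]]; exists z; split=> //.
  by rewrite XE; exists (a, q').
move=> Xx; apply: contrapT => nx.
(* If [x] is a limit point of no piece, each piece meets some neighbourhood of [x] in at most [x]
   itself. There are finitely many edges, so [filter_forall] gives one neighbourhood for all pieces,
   against [Xx]. *)
have {}nx (p : S * Q) : \forall y \near x, trans q p.1 p.2 -> (f p.1 @` X p.2) y -> y = x.
  have [qp|] := boolP (trans q p.1 p.2); last first.
    by move=> _; near=> y.
  have [H|] := pselect (limit_point (X p.2) (g p.1 x)).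
    by case: nx; exists p; split=> //; exists (g p.1 x) => //; exact: gK.
  rewrite not_limit_pointE => -[U gU UX].
  near=> y => _ [z Xz zy].
  have : U (g p.1 y) by near: y; exact: g_cont.
  by rewrite -zy fK => Uz; rewrite (UX z (conj Xz Uz)) gK.
have [y [yx Xy H]] := Xx _ (filter_forall _ nx).
move: Xy; rewrite XE => -[p [qp fy]].
by move/eqP: yx; apply; apply: (H p).
Unshelve. all: by end_near. Qed.

(** The closure is the union of [X] and its derived system; both solve the equations, which pass to
    unions. *)
Lemma graph_directed_closure (X : Q -> set R) :
  graph_directed X -> graph_directed (closure \o X).
Proof.
move=> XE q; have LE := graph_directed_limit_point XE.
rewrite /= closure_setU_limit_point; apply/seteqP; split=> x.
  case; [rewrite {1}XE|rewrite -[limit_point _]/((limit_point \o X) q) LE];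
    move=> [p [qp [y Xy <-]]]; exists p; split=> //; exists y => //=;
    rewrite closure_setU_limit_point; by [left|right].
move=> [p [qp [y /=]]]; rewrite closure_setU_limit_point => -[] Xy <-.
  by left; rewrite XE; exists p; split=> //; exists y.
right; rewrite -[limit_point _]/((limit_point \o X) q) LE.
by exists p; split=> //; exists y.
Qed.

(* Pulling a point of [X q] back along n edges and pushing an arbitrary point of
   the other system forward along the same edges gives an approximation within
   r^-n, so a closed solution depends only on where it is nonempty. *)
Lemma graph_directed_subset (X Y : Q -> set R) :
  graph_directed X -> graph_directed Y ->
  (forall q, X q `<=` `[0, 1]) -> (forall q, Y q `<=` `[0, 1]) ->
  (forall q, closed (Y q)) -> (forall q, X q !=set0 -> Y q !=set0) ->
  forall q, X q `<=` Y q.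
Proof.
move=> XE YE X01 Y01 Ycl XY.
have approx n : forall q x, X q x -> exists2 y, Y q y & `|x - y| <= r%:R ^- n.
  elim: n => [|n IH] q x Xx.
    have [y Yy] := XY q (ex_intro _ x Xx); exists y => //.
    move: (X01 _ _ Xx) (Y01 _ _ Yy); rewrite /= !in_itv /= expr0 invr1.
    by move=> /andP[? ?] /andP[? ?]; rewrite ler_norml; apply/andP; split; lra.
  move: Xx; rewrite XE => -[[a q'] /= [qq' [x' /IH[y Yy xy] <-]]].
  exists (f a y); first by rewrite YE; exists (a, q'); split=> //; exists y.
  rewrite fB normrM normfV normr_nat exprS invfM mulrC.
  by rewrite ler_wpM2l // invr_ge0.
move=> q x Xx; apply: Ycl => U /nbhs_ballP[e /= e0 eU].
have [n rn] : exists n, (r%:R : R) ^- n < e.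
  have : (fun n => (r%:R^-1 : R) ^+ n) @ \oo --> (0 : R).
    apply: cvg_expr; rewrite normfV normr_nat invf_lt1 ?ltr1n //.
    by rewrite ltr0n ltnW.
  move/cvgrPdist_lt => /(_ e e0)[n _ /(_ n (leqnn n))] /=.
  rewrite sub0r normrN => H; exists n; apply: le_lt_trans H.
  by rewrite exprVn ler_norm.
have [y Yy xy] := approx n q x Xx; exists y; split=> //; apply: eU.
exact: le_lt_trans rn.
Qed.

Lemma graph_directed_derivatives_stabilise (X : Q -> set R) :
  graph_directed X -> (forall q, X q `<=` `[0, 1]) -> (forall q, closed (X q)) ->
  exists k, forall q, limit_point (iter k limit_point (X q)) =
                      iter k limit_point (X q).
Proof.
move=> XE X01 Xcl.
pose Y k q := iter k limit_point (X q).
have YE k : graph_directed (Y k).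
  by elim: k => [//|k IH]; exact: graph_directed_limit_point IH.
have Ycl k q : closed (Y k q).
  case: k => [|k]; first exact: Xcl.
  by apply: limit_point_closed; apply: hausdorff_accessible; exact: Rhausdorff.
have YS k q : Y k.+1 q `<=` Y k q.
  by apply: subset_trans (Ycl k q); exact: subset_limit_point.
have Y01 k q : Y k q `<=` `[0, 1].
  by elim: k => [|k IH]; [exact: X01|exact: subset_trans (YS k q) IH].
pose supp k : {set Q} := [set q | `[< Y k q !=set0 >]]%SET.
(* The derivatives decrease, so this inclusion makes two consecutive supports equal, and
   [graph_directed_subset] then makes the two derivatives equal. *)
suff [k ks] : exists k, supp k \subset supp k.+1.
  exists k => q; apply/seteqP; split; first exact: YS.
  apply: (graph_directed_subset (YE k) (YE k.+1)) => // {}q Yq.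
  have : q \in supp k by rewrite inE; apply/asboolP; exact: Yq.
  by move/(fintype.subsetP ks); rewrite inE => /asboolP.
apply: contrapT => nk.
(* Otherwise every step loses at least one state, which is impossible for more than [#|Q|] steps. *)
have card_supp k : (#|supp k| + k <= #|Q|)%N.
  elim: k => [|k IH]; first by rewrite addn0 max_card.
  rewrite addnS (leq_trans _ IH) // ltn_add2r proper_card //.
  apply/andP; split; last by apply/negP => ks; apply: nk; exists k.
  apply/fintype.subsetP => q; rewrite inE => /asboolP Yq.
  have [x Yx] := Yq; rewrite inE; apply/asboolP; exists x; exact: YS Yx.
by have := card_supp #|Q|.+1; rewrite addnS ltnNge leq_addl.
Qed.

End GraphDirected.

(** * Coordinates of the words accepted from a state *)

Definition accepts_from (S : finType) (M : buchi S) (q : state M)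
    (w : word S) : Prop :=
  exists rho : nat -> state M, [/\ rho 0%N = q,
    forall n, trans (rho n) (w n) (rho n.+1) &
    forall N, exists n, (N <= n)%N /\ rho n \in final M].

Definition coord_values (R : realType) (r d : nat)
    (M : buchi {ffun 'I_d -> 'I_r}) (i : 'I_d) (q : state M) : set R :=
  (fun w : word {ffun 'I_d -> 'I_r} => nu R (fun n => w n i)) @` accepts_from q.

Lemma coord_proj_coord_values (R : realType) (r d : nat)
    (M : buchi {ffun 'I_d -> 'I_r}) (i : 'I_d) :
  coord_proj i @` (@nu_vec R r d @` [set w | accepts M w]) =
  @coord_values R r d M i (init M).
Proof.
apply/seteqP; split=> [_ [_ [w [rho [[rho0 Mrho] rhoF]] <-] <-]|_ [w [rho [rho0 Mrho rhoF]] <-]].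
  by exists w; [exists rho|rewrite /coord_proj mxE].
by exists (nu_vec R w); [exists w => //; exists rho|rewrite /coord_proj mxE].
Qed.

Lemma graph_directed_coord_values (R : realType) (r d : nat)
    (M : buchi {ffun 'I_d -> 'I_r}) (i : 'I_d) :
  graph_directed r (@trans _ M) (fun a => a i : nat) (@coord_values R r d M i).
Proof.
move=> q; apply/seteqP; split.
  move=> _ [w [rho [rho0 Mrho rhoF]] <-]; exists (w 0%N, rho 1%N) => /=.
  split; first by rewrite -rho0.
  exists (nu R (fun n => w n.+1 i)); last by rewrite [RHS]nu_shift.
  exists (fun n => w n.+1) => //; exists (fun n => rho n.+1); split=> // N.
  (* Asking for a visit from N + 1 on makes its index a successor, so the visit survives dropping
     the first state. *)
  have [[|n] [Nn nF]] := rhoF N.+1; first by [].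
  by exists n.
move=> _ [[a q'] /= [qq' [_ [w [rho [rho0 Mrho rhoF]] <-] <-]]].
exists (fun n => if n is n'.+1 then w n' else a); last by rewrite nu_shift.
exists (fun n => if n is n'.+1 then rho n' else q); split=> // [[|n] //|N].
  by rewrite rho0.
by have [n [Nn nF]] := rhoF N; exists n.+1; split=> //; exact: leqW.
Qed.

(** * Countability and the Cantor set *)

Lemma countable_of_iter_limit_point (R : realType) (k : nat) (E : set R) :
  iter k limit_point E = set0 -> countable E.
Proof.
elim: k E => [|k IH] E /=; first by move=> ->; exact: countable0.
(* The innermost derivative is peeled off: by induction [limit_point E] is countable, and [E] adds
   to it only isolated points, of which the line allows countably many. *)
rewrite -iterS iterSr => /IH cE.
apply: (@sub_countable _ _ _ (isolated E `|` limit_point E)).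
  apply: subset_card_le; rewrite -closure_isolated_limit_point.
  exact: subset_closure.
rewrite -bigcup2E; apply: bigcup_countable => // -[|[|n]] _ //=.
exact: countable_isolated.
Qed.

Theorem theorem4p4 (R : realType) (r d : nat) (A : set 'rV[R]_d) :
  (1 < r)%N ->
  A `<=` unit_cube R d ->
  bounded_set A ->
  r_regular r A ->
  (exists i : 'I_d,
     (0 < hausdorff_dim (closure (coord_proj i @` A)) < 1)%E) ->
  exists X : set R, cantor_set X /\ definable1 A X.
Proof.
move=> r_gt1 _ _ [_ [[M ->] AE]] [i /andP[dim_gt0 dim_lt1]].
pose C q : set R := closure (@coord_values R r d M i q).
have CE : C (init M) = closure (coord_proj i @` A).
  by rewrite AE coord_proj_coord_values.
have C01 q : C q `<=` `[0, 1].
  have /closure_id -> : closed (`[0, 1]%classic : set R) by exact: itv_closed.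
  apply: closureS => _ [w _ <-]; rewrite /= in_itv /=; exact: nu_itv.
have Ccl q : closed (C q) by exact: closed_closure.
have [k /(_ (init M))] := graph_directed_derivatives_stabilise r_gt1
  (graph_directed_closure r_gt1 (@graph_directed_coord_values R r d M i)) C01 Ccl.
(* Expressing [X] through the projection of [A], without the automaton, is what allows it to be
   defined in the structure. *)
rewrite /= -/(C _) CE; set X := iter k _ _ => Xperf.
have Xcl : closed X.
  by rewrite -Xperf; apply: limit_point_closed; apply: hausdorff_accessible; exact: Rhausdorff.
have XC : X `<=` C (init M).
  rewrite CE /X; elim: (k) => [//|j IH] /=.
  apply: subset_trans (@subset_limit_point _ _) _.
  apply: subset_trans (closureS IH) _.
  by rewrite -(closure_id _).1 //; exact: closed_closure.
(* Definability: the closure is the projection together with its limit points, and each of the [k]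
   derivatives is one more limit point formula. *)
exists X; split; last first.
  apply: expressible_definable1; rewrite /X; elim: (k) => [|j IH] /=.
    rewrite closure_setU_limit_point; apply: expressible_setU.
      exact: expressible_coord_proj.
    by apply: expressible_limit_point; exact: expressible_coord_proj.
  exact: expressible_limit_point.
split.
(* An empty [X] would make the closed projection countable, hence of dimension at most 0. *)
- apply/set0P; apply: contraTneq dim_gt0 => /countable_of_iter_limit_point.
  by rewrite -leNgt; exact: countable_hausdorff_dim.
- by apply: subclosed_compact Xcl (@segment_compact _ 0 1) _; exact: subset_trans XC (C01 _).
- by have [+ _] := perfectP X; case.
- apply/seteqP; split=> // x Xx.
  rewrite -(hausdorff_dim_lt1_interior dim_lt1) -CE.
  by apply: interiorS Xx.
Qed.
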